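(* For every positive integer $n$ there are polynomial vector fields on $\mathbb{S}^n$ having no invariant meridian hyperplane.
   Context: $\mathbb{S}^n=\{x\in\mathbb{R}^{n+1} : \sum_i x_i^2=1\}$. A polynomial vector field $\chi=(P_1,\ldots,P_{n+1})$ in $\mathbb{R}^{n+1}$ is identified with the operator $\sum_i P_i\,\partial/\partial x_i$. It is a vector field on $\mathbb{S}^n$ if $\chi(\sum_i x_i^2-1)=K(\sum_i x_i^2-1)$ for some real polynomial $K$. The zero set $\{f=0\}$ of a polynomial $f$ is invariant for $\chi$ if $\chi f=Kf$ for some $K\in\mathbb{R}[x_1,\ldots,x_{n+1}]$. A meridian hyperplane is a hyperplane $\{\sum_{i=1}^{n}a_ix_i=0\}$ in $\mathbb{R}^{n+1}$ with $a_i\in\mathbb{R}$, $\sum_{i=1}^{n}a_i^2=1$. *)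

(* Defs.v *)
From HB Require Import structures.
From mathcomp Require Import all_boot all_order all_algebra.
From mathcomp Require Import reals.
From mathcomp Require Import mpoly.

Set Implicit Arguments.
Unset Strict Implicit.
Unset Printing Implicit Defensive.

Import GRing.Theory.
Local Open Scope ring_scope.

Definition poly_vfield (R : realType) (m : nat) : Type :=
  'I_m -> {mpoly R[m]}.

Definition vfield_apply (R : realType) (m : nat) (chi : poly_vfield R m)
    (f : {mpoly R[m]}) : {mpoly R[m]} :=
  \sum_(i < m) chi i * f^`M(i).

(* Invariance of the zero set {f = 0}, expressed through the polynomial f. *)
Definition invariant_zeros (R : realType) (m : nat) (chi : poly_vfield R m)
    (f : {mpoly R[m]}) : Prop :=
  exists K : {mpoly R[m]}, vfield_apply chi f = K * f.

Definition sphere_poly (R : realType) (n : nat) : {mpoly R[n.+1]} :=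
  \sum_(i < n.+1) 'X_i ^+ 2 - 1.

Definition vfield_on_sphere (R : realType) (n : nat)
    (chi : poly_vfield R n.+1) : Prop :=
  exists K : {mpoly R[n.+1]},
    vfield_apply chi (sphere_poly R n) = K * sphere_poly R n.

(* Only the first n of the n + 1 coordinates occur: [widen_ord (leqnSn n)]
   embeds {0, ..., n-1} in {0, ..., n}, missing the last index. *)
Definition meridian_form (R : realType) (n : nat) (a : 'I_n -> R) :
    {mpoly R[n.+1]} :=
  \sum_(i < n) a i *: 'X_(widen_ord (leqnSn n) i).

Definition is_meridian (R : realType) (n : nat) (f : {mpoly R[n.+1]}) : Prop :=
  exists a : 'I_n -> R, \sum_(i < n) a i ^+ 2 = 1 /\ f = meridian_form a.

(* Main.v *)
Require Import Defs.
From HB Require Import structures.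
From mathcomp Require Import all_boot all_order all_algebra.
From mathcomp Require Import reals.
From mathcomp Require Import mpoly.

(** Any polynomial vector field [v] on the ambient space becomes tangent to the
    sphere after removing its radial part: for [s = <v, x>], the field
    [v - s x] multiplies [|x|^2 - 1] by [- 2 s].  Applied to a linear form
    [f = \sum_(i < n) a_i x_i], it gives [\sum_(i < n) a_i v_i - s f], so [f] is
    invariant exactly when it divides [\sum_(i < n) a_i v_i].

    Take [v_i = z ^ i], where [z] is the last coordinate.  Every meridian form
    vanishes on the [z]-axis, so an invariant one forces [\sum_(i < n) a_i z ^ i]
    to vanish there too; since the powers of [z] are linearly independent, all
    [a_i] are zero, against [\sum_i a_i ^ 2 = 1]. *)

Import GRing.Theory.
Local Open Scope ring_scope.

Lemma mderiv_var (R : nzRingType) (m : nat) (i j : 'I_m) :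
  ('X_j : {mpoly R[m]})^`M(i) = (j == i)%:R.
Proof.
rewrite mderivX mnm1E; case: eqP => [->|_]; last by rewrite scale0r.
by rewrite -[X in (X - _)%MM]add0m addmK mpolyX0 scale1r.
Qed.

Lemma vfield_apply_sphere (R : realType) (n : nat) (chi : poly_vfield R n.+1) :
  vfield_apply chi (sphere_poly R n) = (\sum_(i < n.+1) chi i * 'X_i) *+ 2.
Proof.
rewrite /vfield_apply -sumrMnl; apply: eq_bigr => i _.
rewrite /sphere_poly mderivB -[1]/(1%:MP) mderivC subr0 raddf_sum /=.
rewrite (bigD1 i) //= big1 ?addr0 => [|j neq_ji].
  by rewrite expr2 mderivM mderiv_var eqxx mul1r mulr1 -mulr2n mulrnAr.
by rewrite expr2 mderivM mderiv_var (negPf neq_ji) mul0r mulr0 addr0.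
Qed.

Lemma vfield_apply_meridian (R : realType) (n : nat) (chi : poly_vfield R n.+1)
    (a : 'I_n -> R) :
  vfield_apply chi (meridian_form a) =
  \sum_(i < n) a i *: chi (widen_ord (leqnSn n) i).
Proof.
rewrite /vfield_apply /meridian_form.
under eq_bigr => i _ do rewrite raddf_sum mulr_sumr /=.
rewrite exchange_big; apply: eq_bigr => j _ /=.
rewrite (bigD1 (widen_ord (leqnSn n) j)) //= big1 ?addr0 => [|i neq_ij].
  by rewrite mderivZ mderiv_var eqxx -scalerAr mulr1.
by rewrite mderivZ mderiv_var eq_sym (negPf neq_ij) scaler0 mulr0.
Qed.

(** The orthogonal projection of [v] on the tangent spaces of the sphere. *)
Definition tangent_part {R : realType} {m : nat} (v : poly_vfield R m) :
    poly_vfield R m :=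
  fun i => v i - (\sum_(j < m) v j * 'X_j) * 'X_i.

Lemma tangent_part_on_sphere (R : realType) (n : nat)
    (v : poly_vfield R n.+1) :
  vfield_on_sphere (tangent_part v).
Proof.
pose s : {mpoly R[n.+1]} := \sum_(j < n.+1) v j * 'X_j.
exists (- s *+ 2); rewrite vfield_apply_sphere mulrnAl; congr (_ *+ 2).
rewrite /tangent_part -/s /sphere_poly mulrBr mulr1 opprK mulNr addrC mulr_sumr.
by rewrite -sumrB; apply: eq_bigr => i _; rewrite mulrBl -mulrA -expr2.
Qed.

Lemma vfield_apply_tangent_part_meridian (R : realType) (n : nat)
    (v : poly_vfield R n.+1) (a : 'I_n -> R) :
  vfield_apply (tangent_part v) (meridian_form a) =
  \sum_(i < n) a i *: v (widen_ord (leqnSn n) i)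
  - (\sum_(j < n.+1) v j * 'X_j) * meridian_form a.
Proof.
rewrite vfield_apply_meridian /meridian_form mulr_sumr -sumrB.
by apply: eq_bigr => i _; rewrite scalerBr scalerAr.
Qed.

(** Restriction of polynomials to the axis of the last coordinate, with values
    in univariate polynomials so that linear independence of the powers of that
    coordinate can be read off the coefficients. *)
Definition axis_restr (R : realType) (n : nat) : {mpoly R[n.+1]} -> {poly R} :=
  mmap (@polyC R) (fun i => if i == ord_max then 'X else 0).

HB.instance Definition _ (R : realType) (n : nat) :=
  GRing.RMorphism.copy (@axis_restr R n)
    (mmap (@polyC R) (fun i : 'I_n.+1 => if i == ord_max then 'X else 0)).

Lemma axis_restr_last (R : realType) (n : nat) :
  axis_restr R n 'X_ord_max = 'X.
Proof. by rewrite /axis_restr mmapX mmap1U eqxx. Qed.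

Lemma axis_restrZ (R : realType) (n : nat) (c : R) (p : {mpoly R[n.+1]}) :
  axis_restr R n (c *: p) = c *: axis_restr R n p.
Proof. by rewrite /axis_restr mmapZ mul_polyC. Qed.

Lemma axis_restr_meridian (R : realType) (n : nat) (a : 'I_n -> R) :
  axis_restr R n (meridian_form a) = 0.
Proof.
rewrite raddf_sum big1 // => i _; rewrite /= axis_restrZ /axis_restr mmapX.
by rewrite mmap1U -val_eqE /= ltn_eqF ?scaler0.
Qed.

Lemma sum_scale_polyX_eq0 (R : nzRingType) (n : nat) (a : 'I_n -> R) :
  \sum_(i < n) a i *: 'X^i = 0 -> forall i, a i = 0.
Proof.
move=> sum0 i; move/(congr1 (fun p : {poly R} => p`_i)): sum0.
rewrite coef0 coef_sum (bigD1 i) //= big1 ?addr0 => [|j neq_ji].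
  by rewrite coefZ coefXn eqxx mulr1.
by rewrite coefZ coefXn eq_sym val_eqE (negPf neq_ji) mulr0.
Qed.

Definition power_vfield (R : realType) (n : nat) : poly_vfield R n.+1 :=
  fun i => 'X_ord_max ^+ i.

Theorem theorem4p3 (R : realType) (n : nat) (hn : (0 < n)%N) :
  exists chi : poly_vfield R n.+1,
    vfield_on_sphere chi /\
    ~ exists f : {mpoly R[n.+1]}, is_meridian f /\ invariant_zeros chi f.
Proof.
exists (tangent_part (power_vfield R n)).
split; first exact: tangent_part_on_sphere.
move=> [_ [[a [norm_a ->]] [K]]].
rewrite vfield_apply_tangent_part_meridian => /(congr1 (axis_restr R n)).
rewrite rmorphB !rmorphM /= axis_restr_meridian !mulr0 subr0 raddf_sum /=.
under eq_bigr => i _ do rewrite axis_restrZ rmorphXn /= axis_restr_last.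
move/sum_scale_polyX_eq0 => a0; move/eqP: norm_a.
by rewrite big1 ?(eq_sym 0) ?oner_eq0 // => i _; rewrite a0 expr0n.
Qed.
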